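(* Let $r,s,t$ be positive integers with $1\le t\le r-1$, and let $p>1$. There exists $N_+(r,s,t)$ (depending only on $r,s,t$) such that for all $n\ge N_+(r,s,t)$, simultaneously for every real $c\ge0$, if $\mathcal{H}\subseteq\binom{[n]}{r}$ satisfies $\nu(\mathcal{H})\le s$, then $$\Phi_{c,t}(\mathcal{H})\le \Phi_{c,t}(\mathcal{H}_{n,r,s}).$$ Moreover, equality holds if and only if $\mathcal{H}$ is isomorphic to $\mathcal{H}_{n,r,s}$.
   Context: $[n]=\{1,\dots,n\}$ and $\binom{[n]}{r}$ is the collection of all $r$-subsets of $[n]$; an $r$-graph is a family $\mathcal{H}\subseteq\binom{[n]}{r}$, whose members are called edges. For $T\subseteq[n]$, $d_{\mathcal{H}}(T)=|\{H\in\mathcal{H}:T\subseteq H\}|$. The matching number $\nu(\mathcal{H})$ is the maximum number of pairwise disjoint edges of $\mathcal{H}$. For real $c\ge 0$ and $p>0$, $$\Phi_{c,t}(\mathcal{H})=\sum_{T\in\binom{[n]}{t}}\left(c+d_{\mathcal{H}}(T)\right)^p .$$ The family $\mathcal{H}_{n,r,s}$ is $\{H\in\binom{[n]}{r}:H\cap[s]\neq\emptyset\}$. Two families on $[n]$ are isomorphic if a permutation of $[n]$ maps one onto the other. *)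

(* Defs.v *)
From mathcomp Require Import all_boot all_order all_algebra all_fingroup.
From mathcomp Require Import reals exp.
Set Implicit Arguments.
Unset Strict Implicit.
Unset Printing Implicit Defensive.
Import Order.TTheory GRing.Theory Num.Theory.
Local Open Scope ring_scope.

(* The vertex set [n] = {1, ..., n} is represented by 'I_n = {0, ..., n-1}. *)

Definition rsubsets (n r : nat) : {set {set 'I_n}} :=
  [set A : {set 'I_n} | #|A| == r].

Definition degree (n : nat) (H : {set {set 'I_n}}) (T : {set 'I_n}) : nat :=
  #|[set A in H | T \subset A]|.

Definition matching_number (n : nat) (H : {set {set 'I_n}}) : nat :=
  (\max_(M : {set {set 'I_n}} | (M \subset H) && trivIset M) #|M|)%N.

(* The power x `^ p has a real exponent; 0 `^ p = 0 for p != 0. *)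
Definition Phi (R : realType) (p c : R) (t n : nat) (H : {set {set 'I_n}}) : R :=
  \sum_(T in rsubsets n t) (c + (degree H T)%:R) `^ p.

Definition initial_seg (n s : nat) : {set 'I_n} := [set i : 'I_n | (i < s)%N].

Definition hitting_family (n r s : nat) : {set {set 'I_n}} :=
  [set A in rsubsets n r | A :&: initial_seg n s != set0].

Definition family_iso (n : nat) (H G : {set {set 'I_n}}) : Prop :=
  exists sigma : {perm 'I_n}, [set [set sigma x | x in A] | A : {set 'I_n} in H] = G.

(* Main.v *)
Require Import Defs.
From mathcomp Require Import all_boot all_order all_algebra all_fingroup.
From mathcomp Require Import reals exp.
From mathcomp Require hoelder convex interval_inference.
From mathcomp Require Import zify ring lra.
Set Implicit Arguments.
Unset Strict Implicit.
Unset Printing Implicit Defensive.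
Import Order.TTheory GRing.Theory Num.Theory.
Local Open Scope ring_scope.

(** Write G(S) for the family of all r-sets meeting the vertex set S, so that
the extremal family is G([s]).  For large n, an r-graph H with matching number
at most s falls into one of two classes.

Call a vertex heavy when its degree exceeds r (s + 1) C(n - 2, r - 2).  An edge
through a heavy vertex can always be chosen to avoid any prescribed r (s + 1)
other vertices, so disjoint edges can be picked greedily through the heavy
vertices ([greedy_matching]); hence there are at most s of them
([card_heavy_le]).  If there are exactly s, they meet every edge, since an edge
missing them would complete a matching of size s + 1 ([heavy_covers]).  Then H
is contained in G(S) with |S| = s, which is a copy of the extremal family, and
either H = G(S) or the power sum of H is strictly smaller ([Phi_proper]).

Otherwise the heavy vertices lie in a set S of size s - 1, and the set E of the
edges of H missing S has size O(n^(r-2)): those edges meet the vertex set of a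
maximal matching in a light vertex ([card_missing_heavy_le]).  Let w be a vertex
outside S.  Then H is compared with G = G(w |: S).  The function
phi(x) = (c + x)^p is convex and increasing, and the degrees of t-sets in G take
only two values d < D, where D is the degree in the complete r-graph.  On
[0, D], phi lies below its piecewise linear interpolant through 0, d and D, with
equality at d and D.  That interpolant has the form
phi(0) + a x + b max(x - d, 0) with a > 0 and b >= 0, so two integer inequalities
suffice ([sum_lt_two_level]): the degree sum of H is smaller than that of G, i.e.
|H| < |G| ([card_lt_meeting]), and the total excess of the degrees over d is not
larger ([sum_excess_le_meeting]).  In both, passing from S to w |: S gains a
quantity of order n^(r-1), and E can only contribute O(n^(r-2)).  The exponent
p and the shift c enter through phi alone, hence the threshold on n depends
only on r, s and t. *)

(** * Degrees and numbers of edges *)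

Local Open Scope nat_scope.

Lemma card_edge n r (H : {set {set 'I_n}}) A :
  H \subset rsubsets n r -> A \in H -> #|A| = r.
Proof. by move=> /subsetP Hr /Hr /[!inE] /eqP. Qed.

Definition edges_meeting (n r : nat) (S : {set 'I_n}) : {set {set 'I_n}} :=
  [set A in rsubsets n r | A :&: S != set0].

Lemma edges_meeting_sub n r (S : {set 'I_n}) : edges_meeting r S \subset rsubsets n r.
Proof. by apply/subsetP => A /[!inE] /andP[]. Qed.

(** Removing T identifies these sets with the (r - |T|)-subsets of the complement
of T :|: S.  The degrees in the families used below, and the gain made by
enlarging S by a vertex, are instances of this count. *)
Lemma card_rsubsets_avoiding n r (T S : {set 'I_n}) : [disjoint T & S] -> #|T| <= r ->
  #|[set A in rsubsets n r | (T \subset A) && [disjoint A & S]]| =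
  'C(n - (#|T| + #|S|), r - #|T|).
Proof.
move=> dTS leTr.
have -> : n - (#|T| + #|S|) = #|~: (T :|: S)|.
  rewrite [RHS]cardsCs setCK card_ord cardsU.
  by move: dTS; rewrite -setI_eq0 => /eqP ->; rewrite cards0 subn0.
rewrite -cards_draws.
have dis (B : {set 'I_n}) : B \subset ~: (T :|: S) -> B :&: T = set0 /\ B :&: S = set0.
  by rewrite -disjoints_subset -setI_eq0 setIUr setU_eq0 => /andP[/eqP -> /eqP ->].
rewrite -[RHS](@card_in_imset _ _ (fun B => B :|: T)); last first.
  move=> B C /[!inE] /andP[/dis[BT _] _] /andP[/dis[CT _] _] eqBC.
  have kT (X : {set 'I_n}) : X :&: T = set0 -> (X :|: T) :\: T = X.
    by move=> XT; rewrite setDUl setDv setU0 setDE -[X in _ = X](setID _ T) XT set0U setDE.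
  by rewrite -(kT B) // eqBC kT.
apply: eq_card => A; rewrite !inE; apply/idP/imsetP.
- case/and3P=> /eqP cA TA dAS; exists (A :\: T); last first.
    apply/setP=> x; rewrite !inE; case: (boolP (x \in T)) => [/(subsetP TA)->//|_].
    by rewrite orbF.
  rewrite !inE cardsD (setIidPr TA) cA eqxx andbT.
  by apply/subsetP=> x /[!inE] /andP[xT xA]; rewrite negb_or xT (disjointFr dAS xA).
- case=> B /[!inE] /andP[/dis[BT BS] /eqP cB] ->.
  rewrite cardsU BT cards0 subn0 cB subnK // eqxx subsetUr -setI_eq0 setIUl BS set0U.
  by rewrite setI_eq0.
Qed.

Lemma degree_complete n r (T : {set 'I_n}) : #|T| <= r ->
  degree (rsubsets n r) T = 'C(n - #|T|, r - #|T|).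
Proof.
move=> leTr; have := @card_rsubsets_avoiding n r T set0.
rewrite -setI_eq0 setI0 eqxx cards0 addn0 => /(_ isT leTr) <-.
by apply: eq_card => A; rewrite !inE -setI_eq0 setI0 eqxx andbT.
Qed.

Lemma degree_sub n (H G : {set {set 'I_n}}) (T : {set 'I_n}) :
  H \subset G -> degree H T <= degree G T.
Proof.
move=> /subsetP HG; apply/subset_leq_card/subsetP => A.
by rewrite !inE => /andP[/HG -> ->].
Qed.

Lemma degree_set1 n (H : {set {set 'I_n}}) v : degree H [set v] = #|[set A in H | v \in A]|.
Proof. by apply: eq_card => A; rewrite !inE sub1set. Qed.

Lemma degree_meeting_hit n r (S T : {set 'I_n}) : #|T| <= r -> ~~ [disjoint T & S] ->
  degree (edges_meeting r S) T = 'C(n - #|T|, r - #|T|).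
Proof.
move=> leTr hit; rewrite -degree_complete //; apply: eq_card => A; rewrite !inE.
case: (boolP (T \subset A)) => TA; rewrite ?andbF // !andbT.
have -> : A :&: S != set0 by apply: contra hit; rewrite setI_eq0; apply: disjointWl.
by rewrite andbT.
Qed.

(** Stated with an addition: an r-set containing T either meets S or is one of
the sets counted by the binomial on the left. *)
Lemma degree_meeting_miss n r (S T : {set 'I_n}) : #|T| <= r -> [disjoint T & S] ->
  degree (edges_meeting r S) T + 'C(n - (#|T| + #|S|), r - #|T|) =
  'C(n - #|T|, r - #|T|).
Proof.
move=> leTr miss; rewrite -degree_complete // -card_rsubsets_avoiding //.
rewrite /degree -[RHS](cardsID [set A : {set 'I_n} | A :&: S != set0]).
by congr (_ + _); apply: eq_card => A; rewrite !inE ?negbK ?setI_eq0;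
  case: (_ == r); case: (_ \subset A); rewrite ?andbF ?andbT.
Qed.

(** Double counting of the pairs (T, A) with T a t-subset of the edge A. *)
Lemma sum_degree n r t (H : {set {set 'I_n}}) : H \subset rsubsets n r ->
  \sum_(T in rsubsets n t) degree H T = 'C(r, t) * #|H|.
Proof.
move=> Hr.
under eq_bigr do rewrite /degree -sum1dep_card.
rewrite (exchange_big_dep (mem H)) /=; last by move=> T A _ /andP[].
rewrite mulnC -sum_nat_const; apply: eq_bigr => A AH.
rewrite -(card_edge Hr AH) -cards_draws sum1dep_card.
by apply: eq_card => T; rewrite !inE AH andbC.
Qed.

(** * Heavy vertices *)

Lemma matching_number_ge n (H M : {set {set 'I_n}}) :
  M \subset H -> trivIset M -> #|M| <= matching_number H.
Proof. by move=> MH tM; rewrite leq_bigmax_cond ?MH. Qed.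

Lemma matching_insert n r (H M : {set {set 'I_n}}) (A : {set 'I_n}) :
  0 < r -> H \subset rsubsets n r -> M \subset H -> trivIset M ->
  [disjoint A & cover M] -> trivIset (A |: M) /\ A \notin M.
Proof.
move=> r0 Hr MH tM dA; apply: trivIsetU1 => // [B BM|].
  by apply: disjointWr dA; exact: bigcup_sup.
by apply/negP=> /(subsetP MH) /(card_edge Hr); rewrite cards0; lia.
Qed.

(** For each of the |F| vertices u in F, at most C(n - 2, r - 2) edges contain
both v and u. *)
Lemma edge_avoiding n r (H : {set {set 'I_n}}) (v : 'I_n) (F : {set 'I_n}) :
  1 < r -> H \subset rsubsets n r -> v \notin F ->
  #|F| * 'C(n - 2, r - 2) < degree H [set v] ->
  exists2 A, A \in H & (v \in A) && [disjoint A & F].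
Proof.
move=> r1 Hr vF heavy; apply/exists_inP; apply: contraLR heavy.
rewrite negb_exists_in -leqNgt => /forall_inP avoid.
rewrite degree_set1.
have sub : [set A in H | v \in A] \subset
    \bigcup_(u in F) [set A in rsubsets n r | (v \in A) && (u \in A)].
  apply/subsetP=> A /[!inE] /andP[AH vA].
  have := avoid _ AH; rewrite vA /= => /pred0Pn[u /andP[uA uF]].
  apply/bigcupP; exists u => //; rewrite !inE vA [u \in A]uA !andbT.
  by have /[!inE] := subsetP Hr _ AH.
apply: leq_trans (subset_leq_card sub) _.
rewrite -sum_nat_const; elim/big_rec2: _ => [|u B x uF IH]; first by rewrite cards0.
apply: leq_trans (leq_card_setU _ _) _; rewrite leq_add //.
have uv : v != u by apply: contraNneq vF => ->.
have := @degree_complete n r [set v; u]; rewrite cards2 uv => /(_ r1) <-.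
by apply: subset_leq_card; apply/subsetP => A; rewrite !inE subUset !sub1set.
Qed.

(** The threshold is what [edge_avoiding] requires for a forbidden set of
r (s + 1) vertices, the number of vertices covered by s + 1 disjoint edges. *)
Definition heavy n r s (H : {set {set 'I_n}}) : {set 'I_n} :=
  [set v | r * s.+1 * 'C(n - 2, r - 2) < degree H [set v]].

(** One edge is picked through each vertex v of S in turn, avoiding F, the
remaining vertices of S and the edges already picked.  In the induction the
picked edge is added to F; the bound |F| + r |S| <= r (s + 1) is preserved
because v leaves S while r vertices enter F. *)
Lemma greedy_matching n r s (H : {set {set 'I_n}}) (S F : {set 'I_n}) :
  1 < r -> H \subset rsubsets n r -> S \subset heavy r s H -> [disjoint S & F] ->
  #|F| + r * #|S| <= r * s.+1 ->
  exists M : {set {set 'I_n}},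
    [/\ M \subset H, trivIset M, #|M| = #|S| & [disjoint cover M & F]].
Proof.
move=> r1 Hr; move cS: #|S| => k; elim: k S F cS => [|k IH] S F cS SH dSF le.
  exists set0; split; rewrite ?sub0set ?cards0 //; first by apply/trivIsetP => A; rewrite inE.
  by rewrite /cover big_set0 -setI_eq0 set0I.
have /card_gt0P[v vS] : 0 < #|S| by rewrite cS.
have cS' : #|S :\ v| = k by move: (cardsD1 v S); rewrite vS cS => -[].
have [|| A AH /andP[vA dA]] := @edge_avoiding n r H v (F :|: (S :\ v)) r1 Hr.
- by rewrite !inE eqxx orbF (disjointFr dSF vS).
- have /[!inE] := subsetP SH _ vS; apply: leq_ltn_trans.
  rewrite leq_mul2r; apply/orP; right; apply: leq_trans (leq_card_setU _ _) _.
  by rewrite cS'; nia.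
have cA := card_edge Hr AH.
move: dA; rewrite -setI_eq0 setIUr setU_eq0 !setI_eq0 => /andP[dAF dAS].
have [||| M [MH tM cM dM]] := IH (S :\ v) (F :|: A) cS'.
- by apply: subset_trans (subsetDl _ _) SH.
- rewrite -setI_eq0 setIUr setU_eq0 !setI_eq0 [X in _ && X]disjoint_sym dAS andbT.
  exact: disjointWl (subsetDl _ _) dSF.
- apply: leq_trans le; rewrite mulnS addnA leq_add2r.
  by apply: leq_trans (leq_card_setU _ _) _; rewrite cA.
move: dM; rewrite -setI_eq0 setIUr setU_eq0 !setI_eq0 => /andP[dMF dMA].
have [|tAM nAM] := @matching_insert n r H M A (ltnW r1) Hr MH tM.
  by rewrite disjoint_sym.
exists (A |: M); split=> //.
- by rewrite subUset sub1set AH.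
- by rewrite cardsU1 nAM cM.
- rewrite /cover bigcup_setU big_set1 -setI_eq0 setIUl setU_eq0 !setI_eq0 dAF.
  exact: dMF.
Qed.

Lemma card_heavy_le n r s (H : {set {set 'I_n}}) :
  1 < r -> H \subset rsubsets n r -> matching_number H <= s -> #|heavy r s H| <= s.
Proof.
move=> r1 Hr nu; rewrite leqNgt; apply/negP => lt.
have [S [SH cS]] : exists S : {set 'I_n}, S \subset heavy r s H /\ #|S| = s.+1.
  have: 0 < #|[set S : {set 'I_n} | S \subset heavy r s H & #|S| == s.+1]|.
    by rewrite cards_draws bin_gt0.
  by case/card_gt0P => S /[!inE] /andP[? /eqP ?]; exists S.
have [||M [MH tM cM _]] := @greedy_matching n r s H S set0 r1 Hr SH.
- by rewrite -setI_eq0 setI0.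
- by rewrite cards0 cS.
by have := matching_number_ge MH tM; rewrite cM cS; lia.
Qed.

(** An edge B missing the s heavy vertices is a forbidden set of size r, which
leaves enough room to match the heavy vertices greedily outside B. *)
Lemma heavy_covers n r s (H : {set {set 'I_n}}) :
  1 < r -> H \subset rsubsets n r -> matching_number H <= s -> #|heavy r s H| = s ->
  H \subset edges_meeting r (heavy r s H).
Proof.
move=> r1 Hr nu cS; apply/subsetP => B BH; rewrite inE (subsetP Hr _ BH) /=.
apply/negP => /eqP dB.
have cB := card_edge Hr BH.
have [||M [MH tM cM dM]] := @greedy_matching n r s H _ B r1 Hr (subxx _).
- by rewrite -setI_eq0 setIC dB.
- by rewrite cB cS mulnS.
have [|tBM nBM] := @matching_insert n r H M B (ltnW r1) Hr MH tM.
  by rewrite disjoint_sym.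
have := @matching_number_ge n H (B |: M); rewrite subUset sub1set BH MH cardsU1 nBM cM cS.
by move=> /(_ isT tBM); lia.
Qed.

(** The vertices of an inclusion-maximal matching meet every edge. *)
Lemma cover_of_maximal_matching n r s (H : {set {set 'I_n}}) :
  0 < r -> H \subset rsubsets n r -> matching_number H <= s ->
  exists2 V : {set 'I_n}, #|V| <= r * s & H \subset edges_meeting r V.
Proof.
move=> r0 Hr nu.
have [|M /maxsetP[/andP[MH tM] maxM]] :=
    @ex_maxset _ (fun M : {set {set 'I_n}} => (M \subset H) && trivIset M).
  by exists set0; rewrite sub0set; apply/trivIsetP => A; rewrite inE.
exists (cover M).
  apply: leq_trans (leq_card_cover M).1 _.
  apply: leq_trans (_ : #|M| * r <= _).
    by rewrite -sum_nat_const; apply: leq_sum => A /(subsetP MH)/(card_edge Hr) ->.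
  by rewrite mulnC leq_mul2l (leq_trans (matching_number_ge MH tM) nu) orbT.
apply/subsetP => B BH; rewrite inE (subsetP Hr _ BH) /=.
apply/negP => /eqP dB.
have [|tBM nBM] := @matching_insert n r H M B r0 Hr MH tM.
  by rewrite -setI_eq0 dB.
by case/negP: nBM; rewrite -(maxM (B |: M)) ?setU11 ?subsetUr // subUset sub1set BH MH.
Qed.

(** Those edges meet a cover of at most r s vertices in a vertex outside S,
which is light. *)
Lemma card_missing_heavy_le n r s (H : {set {set 'I_n}}) (S : {set 'I_n}) :
  0 < r -> H \subset rsubsets n r -> matching_number H <= s -> heavy r s H \subset S ->
  #|[set A in H | [disjoint A & S]]| <= r * s * (r * s.+1 * 'C(n - 2, r - 2)).
Proof.
move=> r0 Hr nu hS; have [V cV HV] := cover_of_maximal_matching r0 Hr nu.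
have sub : [set A in H | [disjoint A & S]] \subset
    \bigcup_(v in V :\: S) [set A in H | v \in A].
  apply/subsetP=> A /[!inE] /andP[AH dAS].
  have /[!inE] /andP[_ /set0Pn[v /setIP[vA vV]]] := subsetP HV _ AH.
  by apply/bigcupP; exists v; rewrite !inE ?AH // vV (disjointFr dAS vA).
apply: leq_trans (subset_leq_card sub) _.
apply: leq_trans (_ : #|V :\: S| * (r * s.+1 * 'C(n - 2, r - 2)) <= _); last first.
  by rewrite leq_mul2r (leq_trans (subset_leq_card (subsetDl V S)) cV) orbT.
rewrite -sum_nat_const; elim/big_rec2: _ => [|u B x /setDP[_ uS] IH]; first by rewrite cards0.
apply: leq_trans (leq_card_setU _ _) _; rewrite leq_add // -degree_set1 leqNgt.
by apply: contra uS => uh; apply: (subsetP hS); rewrite inE.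
Qed.

(** * Binomial estimates *)

Lemma bin_pred_le m q : q.*2 <= m.+1 -> 'C(m, q.-1) <= 'C(m, q).
Proof.
case: q => // q le /=; rewrite -(@leq_pmul2l q.+1) // mul_bin_left leq_mul2r.
by apply/orP; right; lia.
Qed.

Lemma bin_shift_le m b q : q.*2 <= m -> 'C(m + b, q) <= 2 ^ b * 'C(m, q).
Proof.
move=> le; elim: b => [|b IH]; first by rewrite addn0 mul1n.
apply: leq_trans (_ : 2 * 'C(m + b, q) <= _); last by rewrite expnS -mulnA leq_mul2l IH.
rewrite addnS mul2n -addnn; case: q le {IH} => [|q] le; first by rewrite !bin0.
by rewrite binS leq_add2l; apply: (@bin_pred_le _ q.+1); lia.
Qed.

(** C(m + b, q) has order m^q and C(m, q + 1) has order m^(q+1); the threshold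
comes from (q + 1) C(m, q + 1) = (m - q) C(m, q). *)
Lemma bin_lt_eventually K q b :
  exists N, forall m, N <= m -> K * 'C(m + b, q) < 'C(m, q.+1).
Proof.
exists (q.*2 + K * 2 ^ b * q.+1).+1 => m le.
rewrite -(@ltn_pmul2l q.+1) // mul_bin_left.
apply: leq_ltn_trans (_ : K * 2 ^ b * q.+1 * 'C(m, q) < _).
  rewrite [leqRHS](_ : _ = q.+1 * (K * (2 ^ b * 'C(m, q)))); last by ring.
  by rewrite !leq_mul2l bin_shift_le ?orbT //; lia.
by rewrite ltn_pmul2r ?bin_gt0; lia.
Qed.

Lemma bin_mul_ge a i j : 'C(a, i + j) <= 'C(a, i) * 'C(a, j).
Proof.
elim: j => [|j IH]; first by rewrite addn0 bin0 muln1.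
rewrite -(@leq_pmul2l (i + j).+1) // addnS mul_bin_left.
apply: (@leq_trans (j.+1 * ('C(a, i) * 'C(a, j.+1)))); last first.
  by rewrite leq_mul2r; apply/orP; right; lia.
by rewrite mulnCA mul_bin_left mulnCA leq_mul // leq_sub2l // leq_addl.
Qed.

(** * Comparison with the extremal family *)

(** G(w |: S) contains G(S) and also the C(n - s, r - 1) sets that contain w and
miss S; these outnumber the edges of H missing S. *)
Lemma card_lt_meeting n r s (H : {set {set 'I_n}}) (S : {set 'I_n}) w :
  0 < r -> H \subset rsubsets n r -> w \notin S -> #|S|.+1 = s ->
  #|[set A in H | [disjoint A & S]]| < 'C(n - s, r - 1) ->
  #|H| < #|edges_meeting r (w |: S)|.
Proof.
move=> r0 Hr wS cS few.
have dwS : [disjoint [set w] & S] by rewrite disjoints1.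
have := @card_rsubsets_avoiding n r [set w] S dwS; rewrite cards1 add1n cS => /(_ r0) new.
rewrite -(cardsID [set A : {set 'I_n} | A :&: S != set0]).
rewrite -[leqRHS](cardsID [set A : {set 'I_n} | A :&: S != set0]).
rewrite -addnS leq_add //.
  apply: subset_leq_card; apply/subsetP => A /[!inE] /andP[/(subsetP Hr) /[!inE] ->] /= dA.
  rewrite dA andbT; apply: contra dA => /eqP dA; rewrite -subset0 -dA setIS //.
  exact: subsetUr.
apply: leq_trans (_ : 'C(n - s, r - 1) <= _).
  apply: leq_trans few; rewrite ltnS; apply: subset_leq_card.
  by apply/subsetP => A; rewrite !inE negbK setI_eq0 => /andP[-> ->].
rewrite -new; apply: subset_leq_card; apply/subsetP => A; rewrite !inE sub1set.
case/and3P=> -> wA dA; rewrite negbK setI_eq0 dA /=.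
by apply/set0Pn; exists w; rewrite !inE wA eqxx.
Qed.

(** Here d is the degree in G(w |: S) of a t-set missing w |: S.  A t-set meeting
S has in G(w |: S) the largest possible degree, so it can be discarded.  A t-set
missing S has degree at most d in G(S), so its excess in H is at most the number
of edges through it that miss S; summed up, this is C(r, t) times the number of
such edges.  In G(w |: S), the C(n - s, t - 1) t-sets that contain w and miss S
each have excess C(n - (t + s), r - t). *)
Lemma sum_excess_le_meeting n r s t d (H : {set {set 'I_n}}) (S : {set 'I_n}) w :
  0 < t <= r -> H \subset rsubsets n r -> w \notin S -> #|S|.+1 = s ->
  'C(r, t) * #|[set A in H | [disjoint A & S]]| <=
    'C(n - s, t - 1) * 'C(n - (t + s), r - t) ->
  d = 'C(n - t, r - t) - 'C(n - (t + s), r - t) ->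
  \sum_(T in rsubsets n t) (degree H T - d) <=
  \sum_(T in rsubsets n t) (degree (edges_meeting r (w |: S)) T - d).
Proof.
move=> /andP[t0 tr] Hr wS cS few Ed; set E := [set A in H | _] in few.
have cT (T : {set 'I_n}) : T \in rsubsets n t -> #|T| = t by rewrite inE => /eqP.
have cT' (T : {set 'I_n}) : T \in rsubsets n t -> #|T| <= r by move/cT ->.
have cwS : #|w |: S| = s by rewrite cardsU1 wS.
have ED : 'C(n - t, r - t) - d = 'C(n - (t + s), r - t).
  by rewrite Ed subKn // leq_bin2l //; lia.
have Er : E \subset rsubsets n r.
  by apply: subset_trans Hr; apply/subsetP => A /[!inE] /andP[].
rewrite (bigID (fun T : {set _} => [disjoint T & S])).
rewrite [leqRHS](bigID (fun T : {set _} => [disjoint T & S])) /=.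
rewrite leq_add //; last first.
  apply: leq_sum => T /andP[/[dup] /cT cTt /cT' cTr hit].
  rewrite leq_sub2r // (degree_meeting_hit cTr) ?cTt; last first.
    by apply: contra hit; apply: disjointWr; exact: subsetUr.
  rewrite -cTt -degree_complete //; exact: degree_sub.
apply: (@leq_trans (\sum_(T in rsubsets n t) degree E T)).
  rewrite [leqRHS](bigID (fun T : {set _} => [disjoint T & S])) /=.
  apply: leq_trans (leq_addr _ _).
  apply: leq_sum => T /andP[/[dup] /cT cTt /cT' cTr miss].
  have le1 : degree H T <= degree (edges_meeting r S) T + degree E T.
    rewrite /degree -(cardsID [set A : {set 'I_n} | A :&: S != set0]) leq_add //.
      apply: subset_leq_card; apply/subsetP=> A /[!inE] /andP[/andP[/(subsetP Hr) /[!inE] ->]].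
      by move=> -> ->.
    apply: subset_leq_card; apply/subsetP=> A /[!inE]; rewrite negbK setI_eq0.
    by case/andP=> -> /andP[-> ->].
  have := degree_meeting_miss cTr miss; rewrite cTt.
  have : 'C(n - (t + s), r - t) <= 'C(n - (t + #|S|), r - t) by apply: leq_bin2l; lia.
  by rewrite leq_subLR Ed; lia.
rewrite (sum_degree t Er); apply: leq_trans few _.
have dwS : [disjoint [set w] & S] by rewrite disjoints1.
have := @card_rsubsets_avoiding n t [set w] S dwS; rewrite cards1 add1n cS => /(_ t0) <-.
rewrite -sum_nat_const [leqLHS](eq_bigl (fun T : {set 'I_n} =>
  ((T \in rsubsets n t) && [disjoint T & S]) && (w \in T))); last first.
  by move=> T; rewrite !inE sub1set [_ && (w \in T)]andbC andbCA.
rewrite [leqRHS](bigID (fun T : {set 'I_n} => w \in T)) /=; apply: leq_trans (leq_addr _ _).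
apply: leq_sum => T /andP[/andP[/[dup] /cT cTt /cT' cTr _] wT].
rewrite (degree_meeting_hit cTr) ?cTt ?ED // -setI_eq0.
by apply/set0Pn; exists w; rewrite !inE wT eqxx.
Qed.

Local Open Scope ring_scope.

(** * Convexity *)

(** Convexity of x ^ p on [0, +oo[, cleared of denominators. *)
Lemma powR_chord (R : realType) (p x y z : R) : 1 <= p -> 0 <= x -> x <= y <= z ->
  (z - x) * y `^ p <= (z - y) * x `^ p + (y - x) * z `^ p.
Proof.
move=> p1 x0 /andP[xy yz].
have [xz|xz] := eqVneq x z.
  have -> : y = z by apply/eqP; rewrite eq_le yz -xz xy.
  by rewrite -xz; lra.
have xz' : 0 < z - x by rewrite subr_gt0 lt_neqAle xz (le_trans xy).
have t0 : 0 <= (z - y) / (z - x) by apply: divr_ge0; [rewrite subr_ge0 | exact: ltW].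
have t1 : (z - y) / (z - x) <= 1 by rewrite ler_pdivrMr // mul1r lerD2l lerN2.
have := @hoelder.convex_powR R p p1 (interval_inference.Itv01 t0 t1) x z.
rewrite !classical_sets.in_setE /= !in_itv /= !andbT => /(_ x0 (le_trans x0 (le_trans xy yz))).
rewrite convex.convRE [X in X `^ _ <= _]convex.convRE /=; set l := (z - y) / (z - x).
have -> : unstable.onem l = (y - x) / (z - x).
  by rewrite /unstable.onem /l; field; rewrite gt_eqF.
have -> : l * x + (y - x) / (z - x) * z = y by rewrite /l; field; rewrite gt_eqF.
rewrite -(ler_pM2l xz') => /le_trans; apply.
rewrite le_eqVlt; apply/orP; left; apply/eqP; rewrite /l; field.
by rewrite gt_eqF.
Qed.

(** A form of Karamata's inequality for a comparison family v with two values
d < D.  In general one has to compare the sums of (u i - x)_+ and (v i - x)_+ for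
every threshold x; since v takes only the values d and D, the right-hand side is
linear in x on [0, d] and on [d, D], while the left-hand side is convex and, as
u i <= D, vanishes at x = D along with the right-hand side; so x = 0 and x = d
suffice.  The proof replaces phi by its interpolant psi through 0, d
and D.  Truncated subtraction plays the role of the positive part. *)
Lemma sum_lt_two_level (R : realFieldType) (I : finType) (P : pred I)
    (phi : nat -> R) (d D : nat) (u v : I -> nat) :
  (forall x y z : nat, (x <= y <= z)%N ->
     (z%:R - x%:R) * phi y <= (z%:R - y%:R) * phi x + (y%:R - x%:R) * phi z) ->
  phi 0%N < phi d -> (0 < d < D)%N ->
  (forall i, P i -> (u i <= D)%N) ->
  (forall i, P i -> v i = d \/ v i = D) ->
  (\sum_(i | P i) u i < \sum_(i | P i) v i)%N ->
  (\sum_(i | P i) (u i - d) <= \sum_(i | P i) (v i - d))%N ->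
  \sum_(i | P i) phi (u i) < \sum_(i | P i) phi (v i).
Proof.
move=> conv lt0d /andP[d0 dD] uD vdD lt_sum le_exc.
have d0R : 0 < d%:R :> R by rewrite ltr0n.
have dDR : 0 < D%:R - d%:R :> R by rewrite subr_gt0 ltr_nat.
(* The slope a of psi on [0, d], and the increase b of its slope at d. *)
pose a := (phi d - phi 0%N) / d%:R.
pose b := (phi D - phi d) / (D%:R - d%:R) - a.
pose psi (x : nat) := phi 0%N + (a * x%:R + b * (x - d)%:R).
have a0 : 0 < a by rewrite divr_gt0 // subr_gt0.
have Ea : a * d%:R = phi d - phi 0%N by rewrite divfK // gt_eqF.
have Eb : (a + b) * (D%:R - d%:R) = phi D - phi d.
  by rewrite /b addrC subrK divfK // gt_eqF.
have b0 : 0 <= b.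
  have := conv 0%N d D; rewrite (ltnW dD) => /(_ isT); rewrite !subr0 => cv.
  by rewrite -(pmulr_rge0 _ dDR) -(pmulr_rge0 _ d0R); nra.
have le_psi x : (x <= D)%N -> phi x <= psi x.
  move=> xD; rewrite /psi; have [xd|dx] := leqP x d.
    have /eqP -> : (x - d == 0)%N by [].
    have := conv 0%N x d; rewrite xd => /(_ isT); rewrite !subr0 mulr0 addr0 => cv.
    by rewrite -(ler_pM2l d0R); nra.
  rewrite natrB ?(ltnW dx) //.
  have := conv d x D; rewrite xD (ltnW dx) => /(_ isT) cv.
  by rewrite -(ler_pM2l dDR); nra.
have psi_d : psi d = phi d by rewrite /psi subnn mulr0 addr0 Ea; ring.
have psi_D : psi D = phi D by rewrite /psi natrB ?(ltnW dD) //; nra.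
have eq_psi : \sum_(i | P i) phi (v i) = \sum_(i | P i) psi (v i).
  by apply: eq_bigr => i /vdD [] ->.
apply: (@le_lt_trans _ _ (\sum_(i | P i) psi (u i))).
  by apply: ler_sum => i /uD /le_psi.
rewrite eq_psi !big_split /= ltrD2l -!mulr_sumr -!natr_sum.
by rewrite ltr_leD // ?(ltr_pM2l a0) ?ltr_nat // ler_wpM2l // ler_nat.
Qed.

Lemma powR_shift_convex (R : realType) (p c : R) (x y z : nat) :
  1 < p -> 0 <= c -> (x <= y <= z)%N ->
  (z%:R - x%:R) * (c + y%:R) `^ p <=
  (z%:R - y%:R) * (c + x%:R) `^ p + (y%:R - x%:R) * (c + z%:R) `^ p.
Proof.
move=> p1 c0 xyz.
have := @powR_chord R p (c + x%:R) (c + y%:R) (c + z%:R) (ltW p1).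
rewrite !lerD2l !ler_nat => /(_ (addr_ge0 c0 (ler0n _ _)) xyz).
have shift (a b : R) : c + a - (c + b) = a - b by ring.
by rewrite !shift.
Qed.

Lemma powR_shift_lt (R : realType) (p c : R) (x y : nat) :
  1 < p -> 0 <= c -> (x < y)%N -> (c + x%:R) `^ p < (c + y%:R) `^ p.
Proof.
move=> p1 c0 xy; apply: gt0_ltr_powR; first exact: lt_trans p1.
- by rewrite nnegrE addr_ge0.
- by rewrite nnegrE addr_ge0.
- by rewrite ltrD2l ltr_nat.
Qed.

(** * Power sums *)

(** Each t-subset of an edge of G outside H has a smaller degree in H than
in G. *)
Lemma Phi_proper (R : realType) (p c : R) r t n (H G : {set {set 'I_n}}) :
  1 < p -> 0 <= c -> (t <= r)%N -> G \subset rsubsets n r -> H \proper G ->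
  Phi p c t H < Phi p c t G.
Proof.
move=> p1 c0 tr Gr /properP[HG [A AG AH]].
have cA := card_edge Gr AG.
have /card_gt0P[T /[!inE] /andP[TA cT]] :
    (0 < #|[set T : {set 'I_n} | T \subset A & #|T| == t]|)%N.
  by rewrite cards_draws cA bin_gt0.
have le T' : (c + (degree H T')%:R) `^ p <= (c + (degree G T')%:R) `^ p.
  have := degree_sub T' HG; rewrite leq_eqVlt => /orP[/eqP -> //|lt].
  exact/ltW/powR_shift_lt.
rewrite /Phi (bigD1 T) ?inE //= [ltRHS](bigD1 T) ?inE //=.
rewrite ltr_leD //; last by apply: ler_sum.
apply: powR_shift_lt => //; apply: proper_card; apply/properP; split.
  by apply/subsetP=> B; rewrite !inE => /andP[/(subsetP HG) -> ->].
by exists A; rewrite !inE ?AG ?TA // (negPf AH).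
Qed.

Lemma Phi_perm (R : realType) (p c : R) t n (sigma : {perm 'I_n}) (H : {set {set 'I_n}}) :
  Phi p c t [set [set sigma x | x in A] | A : {set 'I_n} in H] = Phi p c t H.
Proof.
have inj := imset_inj (@perm_inj _ sigma).
rewrite /Phi [LHS](reindex_inj inj) /=; apply: eq_big => T.
  by rewrite !inE card_imset //; exact: perm_inj.
move=> _; congr ((c + _%:R) `^ p); rewrite /degree.
rewrite -[RHS](card_imset _ inj); apply: eq_card => B; rewrite !inE.
apply/andP/imsetP.
- case=> /imsetP[A AH ->] TA; exists A => //; rewrite inE AH /=.
  apply/subsetP=> x xT; have := subsetP TA _ (imset_f sigma xT).
  by rewrite mem_imset //; exact: perm_inj.
- by case=> A /[!inE] /andP[AH TA] ->; rewrite imset_f // imsetS.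
Qed.

(** L X lists the vertices with those of X first; matching L S with L S' position
by position maps S onto S'. *)
Lemma exists_perm_imset n (S S' : {set 'I_n}) :
  #|S| = #|S'| -> exists sigma : {perm 'I_n}, sigma @: S = S'.
Proof.
move=> eqc; pose L (X : {set 'I_n}) := enum X ++ enum (~: X).
have memL X x : x \in L X by rewrite mem_cat !mem_enum inE; case: (x \in X).
have uL X : uniq (L X).
  rewrite cat_uniq !enum_uniq andbT /=; apply/hasPn => x.
  by rewrite !mem_enum inE.
have sL X : size (L X) = n by rewrite size_cat -!cardE cardsC card_ord.
pose f x := nth x (L S') (index x (L S)).
have ltf x : (index x (L S) < size (L S'))%N.
  by rewrite (leq_trans _ (_ : size (L S) <= _)%N) ?index_mem ?sL.
have inj_f : injective f.
  move=> x y; rewrite /f (set_nth_default x y) // => /eqP.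
  rewrite nth_uniq // => /eqP eqi.
  by rewrite -(nth_index x (memL S x)) eqi nth_index.
exists (perm inj_f); apply/eqP; rewrite eqEcard card_imset; last exact: perm_inj.
rewrite eqc leqnn andbT; apply/subsetP => _ /imsetP[x xS ->].
rewrite permE /f nth_cat -cardE -eqc cardE.
have lt : (index x (L S) < size (enum S))%N.
  by rewrite index_cat mem_enum xS index_mem mem_enum.
by rewrite lt -mem_enum mem_nth // -cardE -eqc cardE.
Qed.

Lemma edges_meeting_perm n r (sigma : {perm 'I_n}) (S : {set 'I_n}) :
  [set [set sigma x | x in A] | A : {set 'I_n} in edges_meeting r S] =
  edges_meeting r (sigma @: S).
Proof.
have inj := imset_inj (@perm_inj _ sigma).
apply/setP => B; have -> : B = sigma @: ((sigma^-1)%g @: B).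
  by rewrite -imset_comp (eq_imset (g := id)) ?imset_id // => x /=; rewrite permKV.
rewrite (mem_imset _ _ inj) !inE -imsetI; last by move=> x y _ _; exact: perm_inj.
by rewrite imset_eq0 [in RHS]card_imset //; exact: perm_inj.
Qed.

Lemma edges_meeting_iso n r s (S : {set 'I_n}) :
  (s <= n)%N -> #|S| = s -> family_iso (edges_meeting r S) (hitting_family n r s).
Proof.
move=> sn cS; have [] := @exists_perm_imset _ S (initial_seg n s).
  have inj : injective (widen_ord sn).
    by move=> i j eqij; apply: val_inj; exact: (congr1 val eqij).
  rewrite cS -[LHS]card_ord -cardsT -(card_imset _ inj); apply: eq_card => i.
  rewrite inE; apply/imsetP/idP => [[j _ ->]|lt]; first exact: (ltn_ord j).
  by exists (Ordinal lt) => //; exact: val_inj.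
rewrite -[hitting_family _ _ _]/(edges_meeting r (initial_seg n s)).
by move=> sigma <-; exists sigma; rewrite edges_meeting_perm.
Qed.

Lemma Phi_iso (R : realType) (p c : R) t n (H G : {set {set 'I_n}}) :
  family_iso H G -> Phi p c t H = Phi p c t G.
Proof. by case=> sigma <-; rewrite Phi_perm. Qed.

(** The bound C(n - (s + t), r - 1) is below both gains: it is at most
C(n - s, r - 1), and at most C(n - s, t - 1) C(n - (s + t), r - t) because an
(r - 1)-set splits into a (t - 1)-set and an (r - t)-set. *)
Lemma Phi_lt_meeting (R : realType) (p c : R) r t s n (H : {set {set 'I_n}}) (S : {set 'I_n}) w :
  1 < p -> 0 <= c -> (0 < t < r)%N -> H \subset rsubsets n r ->
  w \notin S -> #|S|.+1 = s ->
  ('C(r, t) * #|[set A in H | [disjoint A & S]]| < 'C(n - (s + t), r - 1))%N ->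
  Phi p c t H < Phi p c t (edges_meeting r (w |: S)).
Proof.
move=> p1 c0 /andP[t0 tr] Hr wS cS few.
have big : (r - 1 <= n - (s + t))%N by rewrite -bin_gt0; apply: leq_ltn_trans few.
have cwS : #|w |: S| = s by rewrite cardsU1 wS.
have cT (T : {set 'I_n}) : T \in rsubsets n t -> #|T| = t by rewrite inE => /eqP.
pose D := 'C(n - t, r - t); pose d := (D - 'C(n - (t + s), r - t))%N.
have d0 : (0 < d)%N.
  rewrite /d /D subn_gt0; have -> : (r - t = (r - t.+1).+1)%N by lia.
  apply: (@leq_trans 'C((n - (t + s)).+1, (r - t.+1).+1)); last by apply: leq_bin2l; lia.
  by rewrite binS -[ltnLHS]addn0 ltn_add2l bin_gt0; lia.
have dD : (d < D)%N.
  by rewrite /d ltn_subrL /D !bin_gt0; lia.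
rewrite /Phi; apply: (sum_lt_two_level (phi := fun k => (c + k%:R) `^ p) (d := d) (D := D)).
- by move=> x y z; apply: powR_shift_convex.
- exact: powR_shift_lt.
- by rewrite d0 dD.
- move=> T /cT cTt; rewrite /D -cTt -degree_complete ?cTt ?(ltnW tr) //; exact: degree_sub.
- move=> T /cT cTt; have cTr : (#|T| <= r)%N by rewrite cTt ltnW.
  have [miss|hit] := boolP [disjoint T & w |: S]; last first.
    by right; rewrite degree_meeting_hit // cTt.
  by left; have := degree_meeting_miss cTr miss; rewrite cTt cwS /d /D => <-; rewrite addnK.
- rewrite (sum_degree t Hr) (@sum_degree n r).
    rewrite ltn_mul2l bin_gt0 (ltnW tr) /=; apply: (@card_lt_meeting n r s) => //.
      exact: leq_trans tr.
    apply: leq_trans (leq_ltn_trans (leq_pmull _ _) few) (leq_bin2l _ _); last by lia.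
    by rewrite bin_gt0 ltnW.
  exact: edges_meeting_sub.
- apply: (@sum_excess_le_meeting n r s) => //; first by rewrite t0 ltnW.
  apply: leq_trans (ltnW few) _.
  have -> : (r - 1 = (t - 1) + (r - t))%N by lia.
  apply: leq_trans (bin_mul_ge _ _ _) _; rewrite addnC leq_mul //.
  by apply: leq_bin2l; lia.
Qed.

Theorem theorem1p1 (r s t : nat) (hr : (0 < r)%N) (hs : (0 < s)%N)
    (ht : (1 <= t <= r - 1)%N) :
  exists N : nat,
    forall (R : realType) (p : R), 1 < p ->
    forall n : nat, (N <= n)%N ->
    forall c : R, 0 <= c ->
    forall H : {set {set 'I_n}},
      H \subset rsubsets n r ->
      (matching_number H <= s)%N ->
      Phi p c t H <= Phi p c t (hitting_family n r s) /\
      (Phi p c t H = Phi p c t (hitting_family n r s) <->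
       family_iso H (hitting_family n r s)).
Proof.
have [t0 tr] : (0 < t)%N /\ (t < r)%N by lia.
have r1 : (1 < r)%N by lia.
(* With m = n - (s + t), the inequality provided for m >= N0 reads
   C(r, t) (r s) (r (s + 1)) C(n - 2, r - 2) < C(n - (s + t), r - 1). *)
have [N0 growth] :=
  bin_lt_eventually ('C(r, t) * (r * s * (r * s.+1))) (r - 2) (s + t - 2).
exists (N0 + (s + t))%N => R p p1 n len c c0 H Hr nu.
have sn : (s <= n)%N by lia.
suff [lt|iso] : Phi p c t H < Phi p c t (hitting_family n r s) \/
    family_iso H (hitting_family n r s).
- split; first exact: ltW.
  by split=> [eq|/(@Phi_iso R p c t) eq]; move: lt; rewrite eq ltxx.
- by rewrite (Phi_iso p c t iso) lexx; split.
have := card_heavy_le r1 Hr nu; rewrite leq_eqVlt => /orP[/eqP full|few].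
- have iso := edges_meeting_iso r sn full.
  have sub := heavy_covers r1 Hr nu full.
  have [eqH|neH] := eqVneq H (edges_meeting r (heavy r s H)).
    by right; rewrite {1}eqH.
  left; rewrite -(Phi_iso p c t iso); apply: (@Phi_proper R p c r) => //.
  + exact: ltnW.
  + exact: edges_meeting_sub.
  + by rewrite properEneq neH.
- left.
  have [S [hS cS]] : exists S : {set 'I_n}, heavy r s H \subset S /\ #|S|.+1 = s.
    have /card_gt0P[X /[!inE] /andP[Xh /eqP cX]] : (0 < #|[set X : {set 'I_n} |
        X \subset ~: heavy r s H & #|X| == s.-1 - #|heavy r s H| ]|)%N.
      by rewrite cards_draws bin_gt0 [leqRHS]cardsCs setCK card_ord; lia.
    exists (heavy r s H :|: X); rewrite subsetUl cardsU cX.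
    have -> : heavy r s H :&: X = set0.
      by apply/eqP; rewrite setI_eq0 disjoint_sym disjoints_subset.
    by rewrite cards0; split=> //; lia.
  have [w wS] : exists w, w \notin S.
    have /card_gt0P[w] : (0 < #|~: S|)%N by rewrite cardsCs setCK card_ord; lia.
    by rewrite inE; exists w.
  have cwS : #|w |: S| = s by rewrite cardsU1 wS.
  rewrite -(Phi_iso p c t (edges_meeting_iso r sn cwS)).
  apply: (Phi_lt_meeting (s := s)) => //; first by rewrite t0.
  apply: leq_ltn_trans (_ : _ <= 'C(r, t) * (r * s * (r * s.+1 * 'C(n - 2, r - 2))))%N _.
    by rewrite leq_mul2l (card_missing_heavy_le hr Hr nu hS) orbT.
  have := growth (n - (s + t))%N; have -> : (n - (s + t) + (s + t - 2) = n - 2)%N by lia.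
  have -> : ((r - 2).+1 = r - 1)%N by lia.
  rewrite !mulnA; apply; lia.
Qed.
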